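(* Let $R$ be an ordered ring that is not a division ring, with set of positives $P$, and suppose that $1$ is not the smallest positive element of $R$, i.e. there is $p\in P$ with $p<1$. Then there exist positive integers $m,n$ and data $A\in R^{m\times n}$, $\vec b\in R^m$, $\vec c\in R^n$ such that at least one of the two associated programs (the primal program or the dual program) is feasible and bounded but does not attain an optimal solution.
   Context: Rings are associative with identity $1$, not necessarily commutative. A ring $R$ is ordered if there is a non-empty subset $P\subset R$ (the positives) such that: (1) $R$ is the disjoint union $P\sqcup\{0\}\sqcup -P$; (2) $a,b\in P$ implies $a+b\in P$; (3) $a,b\in P$ implies $ab\in P$. Write $a>b$ if $a-b\in P$, and $a\ge b$ if $a-b\in P\cup\{0\}$. Inequalities between vectors are entrywise. Given $A\in R^{m\times n}$, $\vec b\in R^m$, $\vec c\in R^n$, the primal program is: find $\vec x\in R^n$ with $A\vec x\le \vec b$ and $\vec x\ge 0$ (such $\vec x$ are called feasible) maximizing $f(\vec x)=\vec c^{\,T}\vec x$. The dual program is: find $\vec y\in R^m$ with $\vec y^{\,T}A\ge \vec c^{\,T}$ and $\vec y\ge 0$ (such $\vec y$ are called feasible) minimizing $g(\vec y)=\vec y^{\,T}\vec b$. A program is feasible if it has a feasible vector. The primal program is bounded if there is $r\in R$ with $f(\vec x)\le r$ for all feasible $\vec x$; the dual program is bounded if there is $r\in R$ with $g(\vec y)\ge r$ for all feasible $\vec y$. An optimal solution is a feasible vector attaining the maximum of $f$ (respectively the minimum of $g$) over all feasible vectors. *)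

(* Defs.v *)
From HB Require Import structures.
From mathcomp Require Import all_boot all_order all_algebra.
Set Implicit Arguments.
Unset Strict Implicit.
Unset Printing Implicit Defensive.
Import GRing.Theory.
Local Open Scope ring_scope.

(* [R] need not be commutative, so MathComp's ordered-ring structures, which
   extend integral domains, do not apply; the set [P] of positives is explicit.
   [R] is only assumed to be a possibly zero ring: nontriviality follows from
   [pos_nonempty] and [pos_not0]. *)
Record positives (R : pzRingType) (P : R -> Prop) : Prop := Positives {
  pos_nonempty : exists p, P p;
  pos_total : forall a, [\/ P a, a = 0 | P (- a)];
  pos_not0 : ~ P 0;
  pos_notN : forall a, P a -> ~ P (- a);
  pos_add : forall a b, P a -> P b -> P (a + b);
  pos_mul : forall a b, P a -> P b -> P (a * b)
}.

Definition division_ring (R : pzRingType) : Prop :=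
  (1 : R) <> 0 /\
  forall a : R, a <> 0 -> exists b : R, b * a = 1 /\ a * b = 1.

Section LinearProgram.

Variables (R : pzRingType) (P : R -> Prop).

Definition pos_lt (a b : R) : Prop := P (b - a).

Definition pos_le (a b : R) : Prop := P (b - a) \/ b - a = 0.

Definition pos_lemx (p q : nat) (M N : 'M[R]_(p, q)) : Prop :=
  forall i j, pos_le (M i j) (N i j).

Variables (m n : nat) (A : 'M[R]_(m, n)) (b : 'cV[R]_m) (c : 'cV[R]_n).

(* Sides matter: the objectives are [\sum_j c_j * x_j] and [\sum_i y_i * b_i]. *)
Definition primal_obj (x : 'cV[R]_n) : R := (c^T *m x) 0 0.

Definition dual_obj (y : 'cV[R]_m) : R := (y^T *m b) 0 0.

Definition primal_feasible_vec (x : 'cV[R]_n) : Prop :=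
  pos_lemx (A *m x) b /\ pos_lemx 0 x.

Definition dual_feasible_vec (y : 'cV[R]_m) : Prop :=
  pos_lemx c^T (y^T *m A) /\ pos_lemx 0 y.

Definition primal_feasible : Prop := exists x, primal_feasible_vec x.

Definition dual_feasible : Prop := exists y, dual_feasible_vec y.

Definition primal_bounded : Prop :=
  exists r, forall x, primal_feasible_vec x -> pos_le (primal_obj x) r.

Definition dual_bounded : Prop :=
  exists r, forall y, dual_feasible_vec y -> pos_le r (dual_obj y).

Definition primal_optimal (x : 'cV[R]_n) : Prop :=
  primal_feasible_vec x /\
  forall x', primal_feasible_vec x' -> pos_le (primal_obj x') (primal_obj x).

Definition dual_optimal (y : 'cV[R]_m) : Prop :=
  dual_feasible_vec y /\
  forall y', dual_feasible_vec y' -> pos_le (dual_obj y) (dual_obj y').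

End LinearProgram.

(* Main.v *)
Require Import Defs.
From HB Require Import structures.
From mathcomp Require Import all_boot all_order all_algebra.
From Stdlib Require Import Classical.
Set Implicit Arguments.
Unset Strict Implicit.
Unset Printing Implicit Defensive.
Import GRing.Theory.
Local Open Scope ring_scope.

(** In one variable, consider the positive elements without right inverse.
    - If [a < 1] is one, maximise [a x] subject to [a x <= 1]: the slack
      [d = 1 - a x] never vanishes, and [x + d] is feasible with a larger
      value since [a d < d].
    - Otherwise take any such [a] and minimise [y] subject to [y a >= 1].  For
      every [y > 0] the product [y a] has no right inverse either, so
      [y a > 1]; hence the feasible set is [y > 0], where [p y < y] for the
      given [p < 1]. *)

Section OrderedRing.

Variables (R : pzRingType) (P : R -> Prop).
Hypothesis posP : positives P.

Lemma pos_1 : P 1.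
Proof.
have [p Pp] := pos_nonempty posP.
case: (pos_total posP 1) => // [one0|PN1].
  by case: (pos_not0 posP); rewrite -(mulr0 p) -one0 mulr1.
by rewrite -(mulr1 1) -mulrNN; apply: (pos_mul posP).
Qed.

Lemma pos_mulf_eq0 (a b : R) : P a -> b * a = 0 -> b = 0.
Proof.
move=> Pa ba0; case: (pos_total posP b) => // [Pb|PNb].
  by case: (pos_not0 posP); rewrite -ba0; apply: (pos_mul posP).
by case: (pos_not0 posP); rewrite -oppr0 -ba0 -mulNr; apply: (pos_mul posP).
Qed.

(** The sign of [a * b = 1] forces [b] to be positive. Since
    [(b * a - 1) * b = b * (a * b) - b = 0], cancelling [b] on the right gives the claim. *)
Lemma pos_mulr_eq1C (a b : R) : P a -> a * b = 1 -> b * a = 1.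
Proof.
move=> Pa ab1; apply/subr0_eq.
have Pb : P b.
  case: (pos_total posP b) => // [b0|PNb].
    by case: (pos_not0 posP); move: pos_1; rewrite -ab1 b0 mulr0.
  case: (pos_notN posP pos_1); rewrite -ab1 -mulrN.
  exact: (pos_mul posP).
by apply: (pos_mulf_eq0 Pb); rewrite mulrBl mul1r -mulrA ab1 mulr1 subrr.
Qed.

(** From [y * (a * b) = 1] the factors may be swapped, so [b * y] inverts [a] on the right.
    Contrapositively, a left factor [y] cannot repair the lack of a right inverse. *)
Lemma pos_right_inv_mull (a y : R) : P y ->
  (exists b, y * a * b = 1) -> exists b, a * b = 1.
Proof.
move=> Py [b yab1]; exists (b * y).
by rewrite mulrA; apply: pos_mulr_eq1C => //; rewrite mulrA.
Qed.

Lemma pos_not_right_inv : ~ division_ring R ->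
  exists a, P a /\ ~ exists b, a * b = 1.
Proof.
move=> ndivR; apply: NNPP => allinv; apply: ndivR.
have invP a : P a -> exists b, b * a = 1 /\ a * b = 1.
  move=> Pa; have [b ab1] : exists b, a * b = 1.
    by apply: NNPP => noinv; apply: allinv; exists a.
  by exists b; split=> //; apply: pos_mulr_eq1C.
split=> [one0|a a0]; first by case: (pos_not0 posP); rewrite -one0; apply: pos_1.
(* For negative [a], negate the inverse of [- a]. *)
case: (pos_total posP a) => [/invP //|//|/invP [b [bNa Nab]]].
by exists (- b); rewrite mulNr -mulrN bNa mulrN -mulNr.
Qed.

Lemma pos_leNgt (a b : R) : pos_le P a b -> ~ P (a - b).
Proof.
rewrite -opprB => -[Pab|ab0]; first exact: (pos_notN posP).
by rewrite ab0 oppr0; apply: (pos_not0 posP).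
Qed.

Lemma primal_not_attained (a : R) :
  P a -> P (1 - a) -> ~ (exists b, a * b = 1) ->
  let A := const_mx a : 'M_(1, 1) in
  let b := const_mx 1 : 'cV_1 in
  let c := const_mx a : 'cV_1 in
  [/\ primal_feasible P A b, primal_bounded P A b c
    & ~ exists x, primal_optimal P A b c x].
Proof.
move=> Pa Pa1 noinv A b c.
have objE x : primal_obj c x = a * x 0 0.
  by rewrite /primal_obj mxE big_ord1 !mxE.
have feasE x : primal_feasible_vec P A b x <->
    pos_le P (a * x 0 0) 1 /\ pos_le P 0 (x 0 0).
  split=> [[/(_ 0 0) + /(_ 0 0)]|[h1 h2]].
    by rewrite !mxE big_ord1 !mxE.
  by split=> i j; rewrite !ord1 ?mxE ?big_ord1 ?mxE.
split.
- exists 0; apply/feasE; rewrite mxE mulr0; split; last by right; rewrite subrr.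
  by left; rewrite subr0; apply: pos_1.
(* The objective is the left side of the constraint, so [1] bounds it. *)
- by exists 1 => x /feasE []; rewrite objE.
case=> x [/feasE [ax1 x0] opt].
set d := 1 - a * x 0 0.
have Pd : P d by case: ax1 => // /subr0_eq ax1; case: noinv; exists (x 0 0).
have /opt : primal_feasible_vec P A b (const_mx (x 0 0 + d)).
  apply/feasE; rewrite mxE; split; left.
    (* The new slack is [d - a * d = (1 - a) * d], a product of positives. *)
    rewrite mulrDr opprD addrA -/d -{1}[d]mul1r -mulrBl.
    exact: (pos_mul posP).
  rewrite subr0; case: x0; rewrite subr0; last by move->; rewrite add0r.
  by move=> Px; apply: (pos_add posP).
rewrite !objE mxE => /pos_leNgt; apply.
by rewrite mulrDr [X in P X]addrC addKr; apply: (pos_mul posP).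
Qed.

Lemma dual_not_attained (a p : R) :
  P p -> P (1 - p) -> (forall y, P y -> P (y * a - 1)) ->
  let A := const_mx a : 'M_(1, 1) in
  let b := const_mx 1 : 'cV_1 in
  let c := const_mx 1 : 'cV_1 in
  [/\ dual_feasible P A c, dual_bounded P A b c
    & ~ exists y, dual_optimal P A b c y].
Proof.
move=> Pp Pp1 yaP A b c.
have objE y : dual_obj b y = y 0 0.
  by rewrite /dual_obj mxE big_ord1 !mxE mulr1.
have feasE y : dual_feasible_vec P A c y <-> P (y 0 0).
  split=> [[/(_ 0 0) + /(_ 0 0)]|Py].
    (* The value [0] is infeasible, as it would give [1 <= 0 * a = 0]. *)
    rewrite !mxE big_ord1 !mxE => ya1 []; rewrite subr0 // => y0.
    case: (pos_leNgt ya1); rewrite y0 mul0r subr0; exact: pos_1.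
  split=> i j; rewrite !ord1 ?mxE ?big_ord1 ?mxE; left; last by rewrite subr0.
  exact: yaP.
split.
- by exists (const_mx 1); apply/feasE; rewrite mxE; apply: pos_1.
- by exists 0 => y /feasE Py; left; rewrite objE subr0.
case=> y [/feasE Py opt].
have /opt : dual_feasible_vec P A c (const_mx (p * y 0 0)).
  by apply/feasE; rewrite mxE; apply: (pos_mul posP).
rewrite !objE mxE => /pos_leNgt; apply.
by rewrite -{1}[y 0 0]mul1r -mulrBl; apply: (pos_mul posP).
Qed.

End OrderedRing.

Theorem theorem3p10 (R : pzRingType) (P : R -> Prop)
    (posP : positives P) (ndivR : ~ division_ring R)
    (lt1P : exists p : R, P p /\ pos_lt P p 1) :
  exists (m n : nat) (A : 'M[R]_(m, n)) (b : 'cV[R]_m) (c : 'cV[R]_n),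
    [/\ (0 < m)%N, (0 < n)%N &
      [/\ primal_feasible P A b, primal_bounded P A b c
        & ~ exists x, primal_optimal P A b c x]
      \/
      [/\ dual_feasible P A c, dual_bounded P A b c
        & ~ exists y, dual_optimal P A b c y]].
Proof.
case: (classic (exists a, [/\ P a, P (1 - a) & ~ exists b, a * b = 1])).
  case=> a [Pa Pa1 noinv]; do 2 exists 1%N.
  exists (const_mx a), (const_mx 1), (const_mx a); split=> //; left.
  exact: (primal_not_attained posP).
move=> inv_lt1; have [p [Pp Pp1]] := lt1P.
have [a [Pa noinv]] := pos_not_right_inv posP ndivR.
do 2 exists 1%N; exists (const_mx a), (const_mx 1), (const_mx 1); split=> //.
right; apply: (dual_not_attained posP Pp Pp1) => y Py.
have noinv_ya : ~ exists b, y * a * b = 1.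
  by move/(pos_right_inv_mull posP Py).
(* Equality [y * a = 1] would make [1] a right inverse of [y * a]; if [y * a < 1], then [y * a] is
   an element of the kind [inv_lt1] excludes. *)
case: (pos_total posP (y * a - 1)) => // [/subr0_eq ya1|].
  by case: noinv_ya; exists 1; rewrite mulr1.
rewrite opprB => Pya1; case: inv_lt1; exists (y * a).
by split=> //; apply: (pos_mul posP).
Qed.
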